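(* For an $s$-stage explicit Runge-Kutta method with coefficients $a_{ij}$, $b_i$ to be a 2N-storage method (with 2N-storage coefficients satisfying $A_i\ne 0$ for $i=2,\dots,s$), its coefficients must satisfy the conditions that can be represented in the following two equivalent ways: (I) For $i=3,\dots,s$ and $j=2,\dots,i-2$, $$a_{ij}(a_{i-1,j-1}-a_{j,j-1})=(a_{i,j-1}-a_{j,j-1})\,a_{i-1,j},$$ and for $i=3,\dots,s$, $$a_{i,i-1}(b_{i-2}-a_{i-1,i-2})=(a_{i,i-2}-a_{i-1,i-2})\,b_{i-1};$$ or (II) For $i=3,\dots,s$ and $j=2,\dots,i-1$, $$a_{ij}(b_{j-1}-a_{j,j-1})=(a_{i,j-1}-a_{j,j-1})\,b_j.$$ That is, the coefficients of every such 2N-storage method satisfy these conditions, and the systems (I) and (II) are equivalent representations of them.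
   Context: An $s$-stage explicit Runge-Kutta method ($a$-form) has real coefficients $a_{ij}$ ($i,j=1,\dots,s$, $a_{ij}=0$ for $i\le j$), $b_i$ and nodes $c_i=\sum_{j=1}^{i-1}a_{ij}$ (so $c_1=0$). With step size $h$ it computes, for the equation $dy/dt=f(t,y)$ and starting from the value $y_0$ at time $t$, $y_i=y_0+h\sum_{j=1}^{i-1}a_{ij}k_j$, $k_i=f(t+c_ih,y_i)$, $i=1,\dots,s$, and $y_{s+1}=y_0+h\sum_{i=1}^s b_ik_i$. 2N-storage method ($A$-form): the method is a 2N-storage method with coefficients $A_1=0,A_2,\dots,A_s$ and $B_1,\dots,B_s$, all $B_i\ne0$, if its stages coincide (identically, as formal linear combinations of $y_0$ and $k_1,\dots,k_s$, treated as independent symbols) with those produced by $y_1=y_0$, $\Delta y_2=hk_1$, $\Delta y_i=A_{i-1}\Delta y_{i-1}+hk_{i-1}$ for $i=3,\dots,s+1$, and $y_i=y_{i-1}+B_{i-1}\Delta y_i$ for $i=2,\dots,s+1$.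
   Formalization: For general tableaux (I) and (II) are not equivalent; (I)⇒(II) is stated when (a_ij, a_{i,j-1}-a_{j,j-1}) ≠ (0,0) for 2≤j<i<s, and (II)⇒(I) when (b_j, b_{j-1}-a_{j,j-1}) ≠ (0,0) for 2≤j≤s-2; 2N-storage methods satisfy both with no extra condition. *)

(* Defs.v *)
From mathcomp Require Import all_boot all_order all_algebra.
From mathcomp Require Import reals.

Set Implicit Arguments.
Unset Strict Implicit.
Unset Printing Implicit Defensive.

Import Order.TTheory GRing.Theory Num.Theory.
Local Open Scope ring_scope.

(* All coefficient families are indexed from 1: only a i j, b i, A i, B i with
   1 <= i, j <= s are meaningful, and values outside this range are never
   constrained nor used. *)

Definition explicit_tableau (R : realType) (s : nat) (a : nat -> nat -> R) :=
  forall i j : nat, (1 <= i <= s)%N -> (1 <= j <= s)%N -> (i <= j)%N ->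
    a i j = 0.

(* Formal linear combinations of the s + 1 independent symbols
   y_0, k_1, ..., k_s: coordinate 0 is the coefficient of y_0 and coordinate i
   the coefficient of k_i. *)
Notation formal R s := 'rV[R]_s.+1.

Definition y0_sym (R : realType) (s : nat) : formal R s := delta_mx 0 ord0.

(* inord i is a junk value unless i <= s; only 1 <= i <= s is ever used. *)
Definition k_sym (R : realType) (s i : nat) : formal R s :=
  delta_mx 0 (inord i).

Definition rk_stage (R : realType) (s : nat) (a : nat -> nat -> R)
    (h : R) (i : nat) : formal R s :=
  y0_sym R s + h *: \sum_(1 <= j < i) a i j *: k_sym R s j.

Definition rk_final (R : realType) (s : nat) (b : nat -> R)
    (h : R) : formal R s :=
  y0_sym R s + h *: \sum_(1 <= i < s.+1) b i *: k_sym R s i.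

(* Delta y_i, meaningful for 2 <= i <= s + 1. *)
Fixpoint twoN_delta (R : realType) (s : nat) (A : nat -> R)
    (h : R) (i : nat) : formal R s :=
  match i with
  | 0 | 1 => 0
  | 2 => h *: k_sym R s 1
  | i'.+1 => A i' *: twoN_delta s A h i' + h *: k_sym R s i'
  end.

(* y_i, meaningful for 1 <= i <= s + 1. *)
Fixpoint twoN_stage (R : realType) (s : nat) (A B : nat -> R)
    (h : R) (i : nat) : formal R s :=
  match i with
  | 0 | 1 => y0_sym R s
  | i'.+1 => twoN_stage s A B h i' + B i' *: twoN_delta s A h i'.+1
  end.

(* The stages are compared coefficient by coefficient in y_0, k_1, ..., k_s,
   for every step size h. *)
Definition is_2N_storage (R : realType) (s : nat)
    (a : nat -> nat -> R) (b A B : nat -> R) :=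
  [/\ A 1%N = 0,
      forall i : nat, (1 <= i <= s)%N -> B i != 0,
      forall (h : R) (i : nat), (1 <= i <= s)%N ->
        twoN_stage s A B h i = rk_stage s a h i
    & forall h : R, twoN_stage s A B h s.+1 = rk_final s b h].

Definition condition_I (R : realType) (s : nat)
    (a : nat -> nat -> R) (b : nat -> R) :=
  (forall i j : nat, (3 <= i <= s)%N -> (2 <= j <= i - 2)%N ->
     a i j * (a (i - 1)%N (j - 1)%N - a j (j - 1)%N) =
     (a i (j - 1)%N - a j (j - 1)%N) * a (i - 1)%N j)
  /\
  (forall i : nat, (3 <= i <= s)%N ->
     a i (i - 1)%N * (b (i - 2)%N - a (i - 1)%N (i - 2)%N) =
     (a i (i - 2)%N - a (i - 1)%N (i - 2)%N) * b (i - 1)%N).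

Definition condition_II (R : realType) (s : nat)
    (a : nat -> nat -> R) (b : nat -> R) :=
  forall i j : nat, (3 <= i <= s)%N -> (2 <= j <= i - 1)%N ->
    a i j * (b (j - 1)%N - a j (j - 1)%N) =
    (a i (j - 1)%N - a j (j - 1)%N) * b j.

(* For a fixed j, the equations of condition_I and condition_II say that two of
   the pairs (a i j, a i (j-1) - a j (j-1)), j < i <= s, and
   (b j, b (j-1) - a j (j-1)) are proportional: condition_I relates row i to
   row i-1, and row j+1 to b, while condition_II relates every row to b.
   Proportionality is transitive only through nonzero pairs, so deducing
   condition_II from condition_I needs the pairs of the intermediate rows
   j < i < s to be nonzero, and the converse needs the pair of b to be nonzero.
   Without such a requirement neither implication holds for all tableaux. *)
Definition rows_nondegenerate (R : realType) (s : nat)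
    (a : nat -> nat -> R) :=
  forall i j : nat, (2 <= j)%N -> (j < i < s)%N ->
    a i j != 0 \/ a i (j - 1)%N != a j (j - 1)%N.

Definition weights_nondegenerate (R : realType) (s : nat)
    (a : nat -> nat -> R) (b : nat -> R) :=
  forall j : nat, (2 <= j)%N -> (j + 2 <= s)%N ->
    b j != 0 \/ b (j - 1)%N != a j (j - 1)%N.

(* Main.v *)
Require Import Defs.
From mathcomp Require Import all_boot all_order all_algebra.
From mathcomp Require Import reals.
From mathcomp Require Import zify ring.

Import Order.TTheory GRing.Theory Num.Theory.
Local Open Scope ring_scope.

(** Write e(i,j) for the coefficient of k_j in y_i at h = 1, so that
    e(i,j) = a_ij for i <= s and e(s+1,j) = b_j. The 2N recursion gives
    e(i,j-1) - e(j,j-1) = A_j e(i,j) for 2 <= j <= i: for fixed j, the pairs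
    (e(i,j), e(i,j-1) - e(j,j-1)) with j < i <= s+1 are all multiples of
    (1, A_j), hence pairwise proportional, and (I) and (II) are instances of
    this. The two converse implications are transitivity of proportionality
    through a nonzero pair. *)

(** Multiply the goal by the nonzero entry of the middle pair, substitute both hypotheses, and
    cancel. *)
Lemma proportional_trans (F : idomainType) (x1 y1 x2 y2 x3 y3 : F) :
  x2 != 0 \/ y2 != 0 -> x1 * y2 = y1 * x2 -> x2 * y3 = y2 * x3 ->
  x1 * y3 = y1 * x3.
Proof.
move=> nz e12 e23; case: nz => [nz|nz]; apply: (mulfI nz).
  have -> : x2 * (x1 * y3) = x1 * (x2 * y3) by ring.
  by rewrite e23 mulrA e12; ring.
have -> : y2 * (x1 * y3) = x1 * y2 * y3 by ring.
by rewrite e12 -mulrA e23; ring.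
Qed.

Section StorageCoefficients.
Variables (R : realType) (s : nat).

Lemma k_sym_coef i j : (i <= s)%N -> (j <= s)%N ->
  k_sym R s i 0 (inord j) = (j == i)%:R.
Proof. by move=> hi hj; rewrite mxE eqxx -val_eqE /= !inordK. Qed.

Lemma y0_sym_coef j : (1 <= j <= s)%N -> y0_sym R s 0 (inord j) = 0.
Proof.
move=> /andP[j0 hj]; rewrite mxE eqxx -val_eqE /= inordK //.
by rewrite gtn_eqF.
Qed.

(** The bound [n] is [i] in [rk_stage] and [s.+1] in [rk_final], so tableau entries and weights are
    read off alike. *)
Lemma formal_coef (c : nat -> R) (h : R) n j : (1 <= j < n)%N -> (n <= s.+1)%N ->
  (y0_sym R s + h *: \sum_(1 <= m < n) c m *: k_sym R s m) 0 (inord j)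
  = h * c j.
Proof.
move=> hj hn; rewrite mxE y0_sym_coef ?add0r; last by lia.
rewrite mxE summxE (bigD1_seq j) ?iota_uniq ?mem_index_iota //=.
rewrite mxE k_sym_coef ?eqxx ?mulr1; [|lia..].
rewrite big_nat_cond big1 ?addr0 // => m /andP[hm mj].
by rewrite mxE k_sym_coef 1?eq_sym ?(negbTE mj) ?mulr0 //; lia.
Qed.

Variables (A B : nat -> R).

Local Notation d i j := (twoN_delta s A 1 i 0 (inord j)).
Local Notation e i j := (twoN_stage s A B 1 i 0 (inord j)).

Lemma delta_coefS i j : (1 <= i <= s)%N -> (j <= s)%N ->
  d i.+1 j = A i * d i j + (j == i)%:R.
Proof.
(* The separate branch for Delta y_2 fits the general recursion because Delta y_1 is 0. *)
case: i => [//|[|i]] hi hj.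
  by rewrite /= scale1r k_sym_coef // mxE mulr0 add0r.
rewrite -[twoN_delta _ _ _ i.+3]/(_ *: twoN_delta s A 1 i.+2 + 1 *: k_sym R s i.+2).
by rewrite scale1r mxE k_sym_coef // mxE.
Qed.

Lemma stage_coefS i j : (1 <= i)%N -> e i.+1 j = e i j + B i * d i.+1 j.
Proof. by case: i => [//|i] _; rewrite [LHS]mxE [X in _ + X]mxE. Qed.

Lemma delta_coef_eq0 i j : (i <= j <= s)%N -> d i j = 0.
Proof.
elim: i => [|i IH] hi; first by rewrite mxE.
case: (posnP i) => [->|i0]; first by rewrite mxE.
by rewrite delta_coefS ?IH ?mulr0 ?add0r ?gtn_eqF //; lia.
Qed.

Lemma stage_coef_eq0 i j : (1 <= j)%N -> (i <= j <= s)%N -> e i j = 0.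
Proof.
move=> j0; elim: i => [|i IH] hi; first by rewrite y0_sym_coef //; lia.
case: (posnP i) => [->|i0]; first by rewrite y0_sym_coef //; lia.
by rewrite stage_coefS // IH ?delta_coef_eq0 ?mulr0 ?addr0 //; lia.
Qed.

(** The symbol k_j enters Delta y_(j+1) with coefficient 1, which becomes A_(j+1) in Delta y_(j+2),
    just when k_(j+1) enters with coefficient 1. From then on each step scales both coefficients by
    the same factor. *)
Lemma delta_coef_shift i j : (1 <= j < i)%N -> (i <= s)%N ->
  d i.+1 j = A j.+1 * d i.+1 j.+1.
Proof.
elim: i => [|i IH] hj hi; first by lia.
rewrite !(@delta_coefS i.+1) //; try lia.
case: (eqVneq j i) => [->|ji].
  have -> : d i.+1 i = 1.
    by rewrite delta_coefS ?delta_coef_eq0 ?mulr0 ?add0r ?eqxx //; lia.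
  rewrite (@delta_coef_eq0 i.+1) ?eqxx ?ltn_eqF //; last by lia.
  by rewrite mulr0 add0r addr0.
rewrite IH; try lia.
have /negbTE-> : j != i.+1 by lia.
by rewrite eqSS (negbTE ji) !addr0 mulrCA.
Qed.

(** Subtracting e(j+1,j) removes the contribution of Delta y_(j+1), which contains k_j but not
    k_(j+1). Every later increment obeys [delta_coef_shift]. *)
Lemma stage_coef_shift i j : (1 <= j < i)%N -> (i <= s.+1)%N -> (j < s)%N ->
  e i j - e j.+1 j = A j.+1 * e i j.+1.
Proof.
move=> + + js; elim: i => [|i IH] hj hi; first by lia.
case: (eqVneq j i) => [<-|ji].
  by rewrite subrr stage_coef_eq0 ?mulr0 //; lia.
rewrite (@stage_coefS i j) ?(@stage_coefS i j.+1); [|lia..].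
rewrite addrAC mulrDr -IH; [|lia..].
have hd : d i.+1 j = A j.+1 * d i.+1 j.+1 by apply: delta_coef_shift; lia.
by rewrite hd mulrCA.
Qed.

Lemma storage_conditions (a : nat -> nat -> R) (b : nat -> R) :
  is_2N_storage s a b A B -> condition_I s a b /\ condition_II s a b.
Proof.
move=> [_ _ hst hfin].
have ea i j : (1 <= j < i)%N -> (i <= s)%N -> a i j = e i j.
  by move=> hj hi; rewrite hst ?formal_coef ?mul1r //; lia.
have eb j : (1 <= j <= s)%N -> b j = e s.+1 j.
  by move=> hj; rewrite hfin formal_coef ?mul1r.
have pa i j : (2 <= j < i)%N -> (i <= s)%N ->
    a i (j - 1)%N - a j (j - 1)%N = A j * a i j.
  case: j => [//|j] hj hi; rewrite subn1 /=.
  by rewrite (ea i j) ?(ea j.+1 j) ?(ea i j.+1) ?stage_coef_shift //; lia.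
(* The weights act as row s+1, a value of [i] that [stage_coef_shift] still covers. *)
have pb j : (2 <= j <= s)%N -> b (j - 1)%N - a j (j - 1)%N = A j * b j.
  case: j => [//|j] hj; rewrite subn1 /=.
  by rewrite (eb j) ?(eb j.+1) ?(ea j.+1 j) ?stage_coef_shift //; lia.
have II : condition_II s a b.
  by move=> i j hi hj; rewrite pa ?pb; [ring|lia..].
split=> //; split=> [i j hi hj|i hi].
  by rewrite !pa; [ring|lia..].
(* The second family of (I) is (II) at j = i-1. *)
have := II i (i - 1)%N hi; rewrite -subnDA; apply; lia.
Qed.

End StorageCoefficients.

Section Equivalence.
Variables (R : realType) (s : nat) (a : nat -> nat -> R) (b : nat -> R).

(** Induction on the row: the second family of (I) links row j+1 to b, and the first then passes
    from row i to row i+1, with row i as the middle pair. *)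
Lemma condition_I_II :
  rows_nondegenerate s a -> condition_I s a b -> condition_II s a b.
Proof.
move=> nd [I1 I2] + j; elim=> [|i IH] hi hj; first by lia.
case: (eqVneq i j) => [eij|neij].
  by have := I2 i.+1 hi; rewrite !subSS !subn0 subn1 -subn1 eij.
have nz : a i j != 0 \/ a i (j - 1)%N - a j (j - 1)%N != 0.
  by rewrite subr_eq0; apply: nd; lia.
apply: (proportional_trans _ _ _ _ _ _ _ nz); last by apply: IH; lia.
by have := I1 i.+1 j hi; rewrite [(i.+1 - 1)%N]subn1 /=; apply; lia.
Qed.

Lemma condition_II_I :
  weights_nondegenerate s a b -> condition_II s a b -> condition_I s a b.
Proof.
move=> nd II; split=> [i j hi hj|i hi].
  (* The pair of b is the middle one: (II) applies to row i and also to row i-1, since 2 <= j <= i-2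
     forces i-1 >= 3. *)
  have nz : b j != 0 \/ b (j - 1)%N - a j (j - 1)%N != 0.
    by rewrite subr_eq0; apply: nd; lia.
  apply: (proportional_trans _ _ _ _ _ _ _ nz); first by apply: II; lia.
  by rewrite mulrC -II 1?mulrC //; lia.
have := II i (i - 1)%N hi; rewrite -subnDA; apply; lia.
Qed.

End Equivalence.

Theorem theorem2 (R : realType) (s : nat)
    (a : nat -> nat -> R) (b : nat -> R) (ha : explicit_tableau s a) :
  (forall A B : nat -> R,
     is_2N_storage s a b A B ->
     (forall i : nat, (2 <= i <= s)%N -> A i != 0) ->
     condition_I s a b /\ condition_II s a b)
  /\ (rows_nondegenerate s a -> condition_I s a b -> condition_II s a b)
  /\ (weights_nondegenerate s a b -> condition_II s a b -> condition_I s a b).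
Proof.
split; first by move=> A B h2N _; exact: (storage_conditions _ _ _ _ _ _ h2N).
by split; [exact: condition_I_II|exact: condition_II_I].
Qed.
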